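(* Let $(A,u)$ be an archimedean vector lattice with distinguished weak order unit $u$, with Yosida space $YA$ and Yosida representation $A \leq D(YA)$. (a) If $p$ is an isolated point of $YA$, then $\{p\} \in \lambda A$. (b) If the set of isolated points of $YA$ is dense in $YA$, then $A$ has SMP (sufficiently many projections).
   Context: For compact Hausdorff $X$, $D(X)$ is the set of continuous $f : X \to \mathbb{R} \cup \{\pm\infty\}$ with $f^{-1}(\mathbb{R})$ dense in $X$; it is a lattice under pointwise order, closed under multiplication by real scalars, with addition only partially defined: $f+g=h$ in $D(X)$ means $h \in D(X)$ and $h(x)=f(x)+g(x)$ on the dense set where $f$ and $g$ are both finite. A weak order unit of a vector lattice $A$ is $u>0$ such that $|a|\wedge u = 0$ implies $a=0$. For $(A,u)$ an archimedean vector lattice with distinguished weak order unit, the Yosida space $YA$ is the compact Hausdorff space of all ideals $M$ of $A$ maximal with respect to $u \notin M$, with the hull-kernel topology. The Yosida representation is a vector lattice isomorphism $\eta$ of $A$ onto a subset $\eta(A) \subseteq D(YA)$ (with all sums of elements of $\eta(A)$ existing in $D(YA)$ and lying in $\eta(A)$) with $\eta(u)=1$ and such that $\eta(A)$ 0-1 separates disjoint closed sets of $YA$ (for disjoint closed $E,F$ some element is $0$ on $E$ and $1$ on $F$). One identifies $A$ with $\eta(A)$ and writes $A \leq D(YA)$. For a clopen set $U \subseteq YA$ and $a \in A$, $a\chi(U) \in D(YA)$ is the function equal to $a$ on $U$ and $0$ off $U$. $\lambda A$ denotes the family of all clopen $U \subseteq YA$ such that $a\chi(U) \in A$ for every $a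 \in A$. A band in $A$ is an ideal closed under existing suprema of subsets of its elements; a projection band is a band $B$ for which $A = B \oplus B'$ for some band $B' \subseteq A$. $A$ has sufficiently many projections (SMP) if each nonzero band contains a nonzero projection band. *)

(* Defs.v *)
From HB Require Import structures.
From mathcomp Require Import all_boot all_order all_algebra.
From mathcomp Require Import all_classical all_reals all_analysis.
Import Order.TTheory GRing.Theory Num.Theory.
Import numFieldNormedType.Exports.

Set Implicit Arguments.
Unset Strict Implicit.
Unset Printing Implicit Defensive.

Local Open Scope classical_set_scope.
Local Open Scope ring_scope.

(* Joining Order.Lattice with GRing.Lmodule is not possible here: in MathComp the
   least structure that is both additive and a lattice is already
   Num.RealDomain.  So only the order is inherited from the library, and the
   binary suprema and infima are operations given with their universal
   properties. *)
HB.mixin Record isVectorLattice (R : realType) A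
    of Num.POrderedZmodule A & GRing.Lmodule R A := {
  vl_leD2r : forall z x y : A, x <= y -> x + z <= y + z;
  vl_scale_ge0 : forall (k : R) (x : A), 0 <= k -> 0 <= x -> 0 <= k *: x;
  vjoin : A -> A -> A;
  vmeet : A -> A -> A;
  vjoin_le : forall x y z : A, (vjoin x y <= z) = (x <= z) && (y <= z);
  le_vmeet : forall x y z : A, (z <= vmeet x y) = (z <= x) && (z <= y) }.

#[short(type="vectorLatticeType")]
HB.structure Definition VectorLattice (R : realType) :=
  { A of isVectorLattice R A & Num.POrderedZmodule A & GRing.Lmodule R A }.

Section VectorLattices.
Context {R : realType} {A : vectorLatticeType R}.
Implicit Types (x y : A) (I B : set A).

Definition vabs x : A := vjoin x (- x).

Definition vl_ideal I : Prop :=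
  [/\ I 0,
      forall (k : R) x y, I x -> I y -> I (k *: x + y) &
      forall x y, I y -> vabs x <= vabs y -> I x].

Definition band B : Prop :=
  vl_ideal B /\ forall S s, S `<=` B -> supremums S s -> B s.

Definition direct_sum B B' : Prop :=
  (forall x, exists y z, [/\ B y, B' z & x = y + z]) /\ B `&` B' = [set 0].

Definition projection_band B : Prop :=
  band B /\ exists B', band B' /\ direct_sum B B'.

Definition weak_order_unit (u : A) : Prop :=
  0 < u /\ forall x, vmeet (vabs x) u = 0 -> x = 0.

Definition maximal_avoiding (u : A) (M : set A) : Prop :=
  [/\ vl_ideal M, ~ M u &
      forall I, vl_ideal I -> ~ I u -> M `<=` I -> I = M].

End VectorLattices.

Definition archimedean {R : realType} (A : vectorLatticeType R) : Prop :=
  forall x y : A, 0 <= x -> (forall n : nat, x *+ n <= y) -> x = 0.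

Definition SMP {R : realType} (A : vectorLatticeType R) : Prop :=
  forall B : set A, band B -> B <> [set 0] ->
    exists P : set A, [/\ projection_band P, P <> [set 0] & P `<=` B].

Definition yosida_space {R : realType} {A : vectorLatticeType R} (u : A) : Type :=
  {M : set A | maximal_avoiding u M}.

HB.instance Definition _ (R : realType) (A : vectorLatticeType R) (u : A) :=
  gen_eqMixin (yosida_space u).
HB.instance Definition _ (R : realType) (A : vectorLatticeType R) (u : A) :=
  gen_choiceMixin (yosida_space u).

(* Up to maximal_avoiding_prime: ideals maximal without u are prime, which makes
   the hull-kernel open sets stable under binary intersection. *)
Section VectorLatticeTheory.
Context {R : realType} {A : vectorLatticeType R}.
Implicit Types (a b m x y z u : A) (M : set A) (k : R).

Lemma vl_leD x y z t : x <= y -> z <= t -> x + z <= y + t.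
Proof.
move=> xy zt; apply: (le_trans (vl_leD2r z _ _ xy)).
by rewrite ![y + _]addrC; exact: vl_leD2r.
Qed.

Lemma vl_subr_ge0 x y : (0 <= y - x) = (x <= y).
Proof.
apply/idP/idP => h; first by have := vl_leD2r x _ _ h; rewrite add0r subrK.
by have := vl_leD2r (- x) _ _ h; rewrite subrr.
Qed.

Lemma vl_leN x y : x <= y -> - y <= - x.
Proof. by rewrite -(vl_subr_ge0 x) -(vl_subr_ge0 (- y)) opprK addrC. Qed.

Lemma vl_scale_le k x y : 0 <= k -> x <= y -> k *: x <= k *: y.
Proof.
move=> k0; rewrite -(vl_subr_ge0 x) -(vl_subr_ge0 (k *: x)) -scalerBr.
exact: vl_scale_ge0.
Qed.

Lemma vl_scale_le2 k l x : 0 <= x -> k <= l -> k *: x <= l *: x.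
Proof.
move=> x0 kl; rewrite -vl_subr_ge0 -scalerBl.
by apply: vl_scale_ge0 => //; rewrite subr_ge0.
Qed.

Lemma vmeetl x y : vmeet x y <= x.
Proof. by have := lexx (vmeet x y); rewrite le_vmeet => /andP[]. Qed.

Lemma vmeetr x y : vmeet x y <= y.
Proof. by have := lexx (vmeet x y); rewrite le_vmeet => /andP[]. Qed.

Lemma vabs_ge x : x <= vabs x.
Proof. by have := lexx (vabs x); rewrite {1}/vabs vjoin_le => /andP[]. Qed.

Lemma vabs_geN x : - x <= vabs x.
Proof. by have := lexx (vabs x); rewrite {1}/vabs vjoin_le => /andP[]. Qed.


Lemma vabs_le x y : x <= y -> - x <= y -> vabs x <= y.
Proof. by move=> h1 h2; rewrite /vabs vjoin_le h1. Qed.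

Lemma vabs_ge0 x : 0 <= vabs x.
Proof.
have h : 0 <= vabs x + vabs x.
  by rewrite -(subrr x); apply: vl_leD; [exact: vabs_ge|exact: vabs_geN].
have e : 2^-1 *: (vabs x + vabs x) = vabs x.
  by rewrite -[X in X + X]scale1r -scalerDl scalerA mulVf ?scale1r//.
by rewrite -e; apply: vl_scale_ge0 h; rewrite invr_ge0 ler0n.
Qed.

Lemma ge0_vabs x : 0 <= x -> vabs x = x.
Proof.
move=> x0; apply/eqP; rewrite eq_le vabs_ge andbT; apply: vabs_le => //.
by apply: (le_trans _ x0); have := vl_leN x0; rewrite oppr0.
Qed.

Lemma vabs_id x : vabs (vabs x) = vabs x.
Proof. exact/ge0_vabs/vabs_ge0. Qed.

Lemma vabsD x y : vabs (x + y) <= vabs x + vabs y.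
Proof.
by apply: vabs_le; rewrite ?opprD; apply: vl_leD;
  rewrite ?vabs_ge ?vabs_geN.
Qed.

Lemma vabsZ k x : vabs (k *: x) <= `|k| *: vabs x.
Proof.
have [k0|k0] := lerP 0 k; rewrite ?(ger0_norm k0) ?(ltr0_norm k0);
  apply: vabs_le.
- exact: vl_scale_le k0 (vabs_ge _).
- by rewrite -scalerN; exact: vl_scale_le (vabs_geN _).
- rewrite -[k *: x]opprK -scalerN -scaleNr.
  by apply: vl_scale_le (vabs_geN _); rewrite oppr_ge0 ltW.
- by rewrite -scaleNr; apply: vl_scale_le (vabs_ge _); rewrite oppr_ge0 ltW.
Qed.

Lemma vl_idealD M x y : vl_ideal M -> M x -> M y -> M (x + y).
Proof. by case=> _ + _ => h Mx My; rewrite -[x]scale1r; exact: h. Qed.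

Lemma vl_idealZ M k x : vl_ideal M -> M x -> M (k *: x).
Proof. by case=> M0 + _ => h Mx; rewrite -[_ *: _]addr0; exact: h. Qed.

Lemma vl_ideal_vabs M x : vl_ideal M -> M x -> M (vabs x).
Proof. by case=> _ _ h Mx; apply: h Mx _; rewrite vabs_id. Qed.

Lemma vl_ideal_vabsN M x : vl_ideal M -> M (vabs x) -> M x.
Proof. by case=> _ _ h Mx; apply: h Mx _; rewrite vabs_id. Qed.

Lemma vl_addMeet m x y z : z <= m + x -> z <= m + y -> z <= m + vmeet x y.
Proof.
move=> h1 h2; rewrite -(subrK m z) addrC; apply: vl_leD => //.
rewrite le_vmeet; apply/andP; split.
  by have := vl_leD2r (- m) _ _ h1; rewrite [m + x]addrC addrK.
by have := vl_leD2r (- m) _ _ h2; rewrite [m + y]addrC addrK.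
Qed.

Lemma vl_scaleMeet k x y z : 0 < k ->
  z <= k *: x -> z <= k *: y -> z <= k *: vmeet x y.
Proof.
move=> k0 h1 h2.
have kV : 0 <= k^-1 by rewrite invr_ge0 ltW.
have e t : z <= k *: t -> k^-1 *: z <= t.
  move=> /(vl_scale_le kV); rewrite scalerA mulVf ?scale1r//.
  by rewrite gt_eqF.
rewrite -[z](scale1r) -(@mulfV _ k) ?gt_eqF// -scalerA.
by apply: vl_scale_le; [exact: ltW|rewrite le_vmeet !e].
Qed.

Lemma maximal_avoiding_step u M a : maximal_avoiding u M -> 0 <= a -> ~ M a ->
  exists m k, [/\ M m, 0 <= m, 0 <= k & vabs u <= m + k *: a].
Proof.
move=> [Mi Mu Mmax] a0 Ma; have [M0 _ Ms] := Mi; apply: contrapT => nex.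
pose J : set A :=
  [set x | exists m k, [/\ M m, 0 <= m, 0 <= k & vabs x <= m + k *: a]].
have MJ : M `<=` J.
  move=> x Mx; exists (vabs x), 0; rewrite vabs_ge0 lexx scale0r addr0 lexx.
  by split => //; exact: vl_ideal_vabs.
have Ji : vl_ideal J.
  split; first exact: MJ.
  - move=> k x y [m [s [Mm m0 s0 xm]]] [n [t [Mn n0 t0 yn]]].
    exists (`|k| *: m + n), (`|k| * s + t); split.
    + by apply: (vl_idealD Mi) => //; exact: vl_idealZ.
    + rewrite -[0]addr0; apply: vl_leD => //.
      exact: vl_scale_ge0.
    + by rewrite addr_ge0// mulr_ge0.
    + apply: (le_trans (vabsD _ _)).
      rewrite scalerDl -scalerA addrACA -scalerDr; apply: vl_leD => //.
      by apply: (le_trans (vabsZ _ _)); exact: vl_scale_le.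
  - move=> x y [m [k [Mm m0 k0 ym]]] xy; exists m, k; split => //.
    exact: le_trans xy ym.
have JM : J = M by apply: Mmax.
by apply: Ma; rewrite -JM; exists 0, 1; rewrite add0r scale1r ge0_vabs.
Qed.

Lemma maximal_avoiding_prime u M a b : maximal_avoiding u M ->
  0 <= a -> 0 <= b -> M (vmeet a b) -> M a \/ M b.
Proof.
move=> Mm a0 b0 Mab; have [Mi Mu _] := Mm; have [_ _ Ms] := Mi.
have [|Ma] := pselect (M a); first by left.
have [|Mb] := pselect (M b); first by right.
exfalso; apply: Mu.
have [m [k [M_m m0 k0 um]]] := maximal_avoiding_step Mm a0 Ma.
have [n [l [M_n n0 l0 un]]] := maximal_avoiding_step Mm b0 Mb.
pose K := k + l + 1.
have K0 : 0 < K by rewrite ltr_wpDl// addr_ge0.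
have Mw : M (m + n + K *: vmeet a b).
  by apply: (vl_idealD Mi); [exact: vl_idealD|exact: vl_idealZ].
apply: Ms Mw _; apply: le_trans (vabs_ge _).
have mn1 : m <= m + n by rewrite -{1}[m]addr0; apply: vl_leD.
have mn2 : n <= m + n by rewrite -{1}[n]add0r; apply: vl_leD.
have ha : vabs u <= m + n + K *: a.
  apply: (le_trans um); apply: vl_leD => //; apply: vl_scale_le2 => //.
  by rewrite /K -addrA lerDl addr_ge0.
have hb : vabs u <= m + n + K *: b.
  apply: (le_trans un); apply: vl_leD => //; apply: vl_scale_le2 => //.
  by rewrite /K -addrA [l + 1]addrC addrA lerDr addr_ge0.
rewrite -[vabs u](subrK (m + n)) addrC.
apply: vl_leD => //; apply: vl_scaleMeet => //.
  by have := vl_leD2r (- (m + n)) _ _ ha; rewrite [m + n + _]addrC addrK.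
by have := vl_leD2r (- (m + n)) _ _ hb; rewrite [m + n + _]addrC addrK.
Qed.

End VectorLatticeTheory.

Section HullKernel.
Context {R : realType} {A : vectorLatticeType R} {u : A}.
Implicit Types (E U : set (yosida_space u)).

Definition hull (S : set A) : set (yosida_space u) := [set p | S `<=` sval p].
Definition kernel E : set A := \bigcap_(p in E) sval p.

(* The closed sets are the E with hull (kernel E) = E; the converse inclusion
   always holds. *)
Definition hk_open U : Prop := hull (kernel (~` U)) `<=` ~` U.

Lemma hk_openT : hk_open setT.
Proof.
move=> p; rewrite setCT /hull /kernel/= bigcap_set0 => up.
by case: (svalP p) => _ + _; case; exact: up.
Qed.

Lemma hk_openI : setI_closed hk_open.
Proof.
move=> U V oU oV p; rewrite setCI => hp.
apply: contrapT => /not_orP[pU pV].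
have /existsNP[a /not_implyP[Ua pa]] : ~ (kernel (~` U) `<=` sval p).
  by move=> /oU; exact: pU.
have /existsNP[b /not_implyP[Vb pb]] : ~ (kernel (~` V) `<=` sval p).
  by move=> /oV; exact: pV.
have pm := svalP p; have [pi _ _] := pm.
have : sval p (vmeet (vabs a) (vabs b)).
  have ab0 : 0 <= (vmeet (vabs a) (vabs b)) by rewrite le_vmeet !vabs_ge0.
  apply: hp => q; have [[_ _ qs] _ _] := svalP q.
  case=> [/Ua qa|/Vb qb].
    by apply: qs qa _; rewrite ge0_vabs// vmeetl.
  by apply: qs qb _; rewrite ge0_vabs// vmeetr.
move=> /(maximal_avoiding_prime pm (vabs_ge0 _) (vabs_ge0 _))[] h.
  by apply: pa; exact: vl_ideal_vabsN h.
by apply: pb; exact: vl_ideal_vabsN h.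
Qed.

Lemma hk_open_bigU (I : Type) (f : I -> set (yosida_space u)) :
  (forall i, hk_open (f i)) -> hk_open (\bigcup_i f i).
Proof.
move=> of_ p hp; rewrite setC_bigcup => i _; apply: of_.
apply: subset_trans hp => a fa q; rewrite setC_bigcup => nf; apply: fa.
exact: nf.
Qed.

HB.instance Definition _ := isOpenTopological.Build (yosida_space u)
  hk_openT hk_openI hk_open_bigU.

End HullKernel.

Section ExtendedRealFunctions.
Context {R : realType} {X : topologicalType}.
Implicit Types f g h : X -> \bar R.

Definition Dspace : set (X -> \bar R) :=
  [set f | continuous f /\ dense [set x | f x \is a fin_num]].

Definition D_sum f g h : Prop :=
  Dspace h /\ forall x, f x \is a fin_num -> g x \is a fin_num ->
    h x = (f x + g x)%E.

End ExtendedRealFunctions.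

Section YosidaRepresentation.
Context {R : realType} {A : vectorLatticeType R} (u : A).

(* These properties determine eta up to a self-homeomorphism of the Yosida space.
   In yosida_scale, 0 * +oo = 0 * -oo = 0 in \bar R, so that 0 *: a is sent to
   the zero function even where eta a is infinite. *)
Record yosida_representation (eta : A -> yosida_space u -> \bar R) : Prop := {
  yosida_D : forall a, Dspace (eta a);
  yosida_inj : injective eta;
  yosida_join : forall a b x,
    eta (vjoin a b) x = Order.max (eta a x) (eta b x);
  yosida_meet : forall a b x,
    eta (vmeet a b) x = Order.min (eta a x) (eta b x);
  yosida_scale : forall (k : R) a x, eta (k *: a) x = (k%:E * eta a x)%E;
  yosida_sum : forall a b, D_sum (eta a) (eta b) (eta (a + b));
  yosida_unit : forall x, eta u x = 1%E;
  yosida_separates : forall E F : set (yosida_space u),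
    closed E -> closed F -> E `&` F = set0 ->
    exists a, (forall x, E x -> eta a x = 0%E) /\
              (forall x, F x -> eta a x = 1%E) }.

Definition lambda_family (eta : A -> yosida_space u -> \bar R) :
    set (set (yosida_space u)) :=
  [set U | clopen U /\
     forall a, range eta (patch (cst 0%E) U (eta a))].

End YosidaRepresentation.

(* Main.v *)
(** An element of [D(YA)] is finite at an isolated point [p], so (a) holds because
[a chi{p}] is a real multiple of the element separating [p] from its
complement.

For (b) no representation is needed.  The ideals maximal without [u]
intersect in 0, so by density a nonzero band contains some [b] lying outside an
isolated [p].  The meet of [|b|], [u] and an [e >= 0] that is in every point
except [p] is an atom [w] of the lattice, and in an archimedean vector lattice the
line spanned by an atom is a projection band. *)
Require Import Defs.
From mathcomp Require Import all_boot all_order all_algebra.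
From mathcomp Require Import all_classical all_reals all_analysis.
Local Open Scope classical_set_scope.
Import Order.TTheory GRing.Theory Num.Theory.
Local Open Scope ring_scope.

(** * Meets and disjointness of positive elements *)

Section VectorLatticeLemmas.
Context {R : realType} {A : vectorLatticeType R}.
Implicit Types (a b m v w x y z u : A) (S I M : set A) (k : R).

Lemma le_vjoinl x y : x <= vjoin x y.
Proof. by have := lexx (vjoin x y); rewrite vjoin_le => /andP[]. Qed.

Lemma le_vjoinr x y : y <= vjoin x y.
Proof. by have := lexx (vjoin x y); rewrite vjoin_le => /andP[]. Qed.

Lemma vmeetC x y : vmeet x y = vmeet y x.
Proof. by apply/eqP; rewrite eq_le !le_vmeet !vmeetl !vmeetr. Qed.

Lemma vmeet_ge0 x y : 0 <= x -> 0 <= y -> 0 <= vmeet x y.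
Proof. by rewrite le_vmeet => -> ->. Qed.

Lemma vmeet_eq0_le x x' y : 0 <= x -> 0 <= y -> x <= x' -> vmeet x' y = 0 ->
  vmeet x y = 0.
Proof.
move=> x0 y0 xx' x'y; apply/eqP; rewrite eq_le vmeet_ge0// andbT -x'y.
by rewrite le_vmeet vmeetr (le_trans (vmeetl _ _) xx').
Qed.

Lemma vl_le_subr x y z : (x <= y - z) = (x + z <= y).
Proof. by rewrite -vl_subr_ge0 -[RHS]vl_subr_ge0 opprD [- x - z]addrC addrA. Qed.

Lemma vl_subr_le x y z : (x - y <= z) = (x <= y + z).
Proof. by rewrite -(vl_subr_ge0 (x - y)) -(vl_subr_ge0 x) opprB addrCA addrA. Qed.

Lemma vabs_eq0 x : vabs x = 0 -> x = 0.
Proof.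
move=> x0; apply/eqP; rewrite eq_le -{1}x0 vabs_ge/=.
by have := vl_leN (vabs_geN x); rewrite opprK x0 oppr0.
Qed.

Lemma vabs0 : vabs (0 : A) = 0.
Proof. exact: ge0_vabs. Qed.

(** Translations preserve meets, so the right side is the meet of [x + y], [y + z] and
    [vmeet x z + z]; by positivity each is above the left side. *)
Lemma vmeetDl x y z : 0 <= x -> 0 <= y -> 0 <= z ->
  vmeet (x + y) z <= vmeet x z + vmeet y z.
Proof.
move=> x0 y0 z0; apply: vl_addMeet; last first.
  by apply: (le_trans (vmeetr _ _)); rewrite -{1}[z]add0r vl_leD ?vmeet_ge0.
rewrite [vmeet x z + y]addrC; apply: vl_addMeet; first by rewrite addrC vmeetl.
by apply: (le_trans (vmeetr _ _)); rewrite -{1}[z]add0r vl_leD.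
Qed.

Lemma vmeetDl_eq0 x y z : 0 <= x -> 0 <= y -> 0 <= z ->
  vmeet x z = 0 -> vmeet y z = 0 -> vmeet (x + y) z = 0.
Proof.
move=> x0 y0 z0 xz yz; apply/eqP; rewrite eq_le vmeet_ge0 ?addr_ge0 ?andbT//.
- by have := vmeetDl x y z x0 y0 z0; rewrite xz yz addr0.
- by rewrite -[0]addr0 vl_leD.
Qed.

Lemma vmeetMn_eq0 x z n : 0 <= x -> 0 <= z -> vmeet x z = 0 ->
  vmeet (x *+ n) z = 0.
Proof.
move=> x0 z0 xz; have xn0 j : 0 <= x *+ j.
  by elim: j => // j ih; rewrite mulrS -[0]addr0 vl_leD.
elim: n => [|n ih]; last by rewrite mulrS vmeetDl_eq0.
by apply/eqP; rewrite mulr0n eq_le vmeetl vmeet_ge0.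
Qed.

(** Reduces real scalars to integer multiples, for which disjointness follows by induction. *)
Lemma scale_le_mulrn x k : 0 <= x -> exists n, k *: x <= x *+ n.
Proof.
move=> x0; exists (Num.bound `|k|); rewrite -scaler_nat vl_scale_le2//.
by rewrite (le_trans (ler_norm k))// ltW// archi_boundP.
Qed.

Lemma vmeetZ_eq0 x z k : 0 <= x -> 0 <= z -> 0 <= k -> vmeet x z = 0 ->
  vmeet (k *: x) z = 0.
Proof.
move=> x0 z0 k0 xz; have [n kn] := scale_le_mulrn x k x0.
apply: (vmeet_eq0_le _ (x *+ n)) => //; first exact: vl_scale_ge0.
exact: vmeetMn_eq0.
Qed.

(** * Positive parts *)

Definition pospart x : A := vjoin x 0.

Lemma pospart_ge0 x : 0 <= pospart x.
Proof. exact: le_vjoinr. Qed.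

Lemma pospart_ge x : x <= pospart x.
Proof. exact: le_vjoinl. Qed.

Lemma pospart_le x y : 0 <= y -> x <= y -> pospart x <= y.
Proof. by rewrite vjoin_le => -> ->. Qed.

Lemma pospart_eq0 x : pospart x = 0 -> x <= 0.
Proof. by move=> <-; exact: pospart_ge. Qed.

Lemma pospartB x : x = pospart x - pospart (- x).
Proof.
have h y : pospart y <= y + pospart (- y).
  apply: pospart_le; last by rewrite -{1}[y]addr0 vl_leD ?pospart_ge0.
  by rewrite -(subrr y) vl_leD ?pospart_ge.
apply/eqP; rewrite eq_le vl_subr_le [_ + x]addrC h andbT vl_le_subr.
by have := h (- x); rewrite opprK addrC vl_le_subr addrC.
Qed.

(** Subtracting the meet from [pospart x] still leaves an upper bound of [x] and 0, so the meet is
    at most 0. *)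
Lemma pospart_disjoint x : vmeet (pospart x) (pospart (- x)) = 0.
Proof.
apply/eqP; rewrite eq_le vmeet_ge0 ?pospart_ge0// andbT.
set v := vmeet _ _.
suff : pospart x <= pospart x - v.
  by rewrite vl_le_subr addrC -vl_le_subr subrr.
apply: pospart_le; first by rewrite vl_subr_ge0 vmeetl.
rewrite {1}[x]pospartB; apply: vl_leD => //; apply: vl_leN; exact: vmeetr.
Qed.

(** * Disjoint complements, the source of all bands constructed here *)

Definition dcompl S : set A :=
  [set x | forall s, S s -> vmeet (vabs x) (vabs s) = 0].

Lemma dcompl_ideal S : vl_ideal (dcompl S).
Proof.
split.
- move=> s _; apply/eqP.
  by rewrite vabs0 eq_le vmeetl vmeet_ge0 ?vabs_ge0.
- move=> k x y Sx Sy s Ss.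
  apply: (vmeet_eq0_le _ (`|k| *: vabs x + vabs y)); rewrite ?vabs_ge0//.
    by apply: (le_trans (vabsD _ _)); apply: vl_leD => //; exact: vabsZ.
  apply: vmeetDl_eq0; rewrite ?vabs_ge0 ?vl_scale_ge0 ?vabs_ge0//.
  - by rewrite vmeetZ_eq0 ?vabs_ge0// Sx.
  - exact: Sy.
- move=> x y Sy xy s Ss.
  by apply: (vmeet_eq0_le _ (vabs y)); rewrite ?vabs_ge0 ?Sy.
Qed.

(* If [t = sup T] and [v = |t| /\ |s|] then [v <= (t - x) /\ |s| + |x| /\ |s|],
   whose last term vanishes, so [t - v] still bounds [T]. *)
Lemma dcompl_band S : band (dcompl S).
Proof.
split; first exact: dcompl_ideal.
move=> T t TS [tT ltT] s Ss; set v := vmeet _ _.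
have v0 : 0 <= v by rewrite vmeet_ge0 ?vabs_ge0.
apply/eqP; rewrite eq_le v0 andbT.
suff : t <= t - v by rewrite vl_le_subr addrC -vl_le_subr subrr.
apply: ltT => x Tx; rewrite vl_le_subr addrC -vl_le_subr.
have tx0 : 0 <= t - x by rewrite vl_subr_ge0; exact: tT.
have vs : v <= vmeet (t - x + vabs x) (vabs s).
  rewrite le_vmeet vmeetr andbT; apply: (le_trans (vmeetl _ _)).
  by have := vabsD (t - x) x; rewrite subrK (ge0_vabs tx0).
apply: (le_trans vs); apply: (le_trans (vmeetDl _ _ _ _ _ _));
  rewrite ?vabs_ge0//.
by rewrite (TS x Tx s Ss) addr0 vmeetl.
Qed.

Lemma dcomplI S : S `&` dcompl S `<=` [set 0].
Proof.
move=> x [Sx /(_ x Sx) xx]; apply: vabs_eq0; apply/eqP.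
by rewrite eq_le vabs_ge0 andbT -xx le_vmeet lexx.
Qed.

Lemma dcompl_dcompl S : S `<=` dcompl (dcompl S).
Proof. by move=> x Sx y Sy; rewrite vmeetC; exact: Sy. Qed.

(** * Atoms of an archimedean vector lattice *)

(** Removes the sign condition in [archimedean]: after division by [n.+1], the bound on [x] also
    bounds [pospart x]. *)
Lemma archimedean_mulrn_le x y : archimedean A -> 0 <= y ->
  (forall n, n.+1%:R *: x <= y) -> x <= 0.
Proof.
move=> arch y0 xy; apply: pospart_eq0; apply: (arch _ y); rewrite ?pospart_ge0//.
case=> [|n]; rewrite ?mulr0n//.
have n0 : 0 <= n.+1%:R^-1 :> R by rewrite invr_ge0.
rewrite -scaler_nat -[y](scalerKV (_ : n.+1%:R != 0 :> R)) ?pnatr_eq0//.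
apply: vl_scale_le => //; apply: pospart_le; first exact: vl_scale_ge0.
rewrite -[x](scalerK (_ : n.+1%:R != 0 :> R)) ?pnatr_eq0//.
exact: vl_scale_le.
Qed.

(* [r] is the largest scalar with [r w <= a]. *)
Lemma atom_decomp w a : archimedean A -> 0 < w -> 0 <= a ->
  (forall y, 0 < y -> y <= w -> exists k, w <= k *: y) ->
  exists r, dcompl [set w] (a - r *: w).
Proof.
move=> arch w0 a0 watom; have w0' := ltW w0.
pose K := [set k : R | k *: w <= a].
have [n nw] : exists n, ~ (w *+ n <= a).
  by apply/existsNP => h; move: w0; rewrite (arch _ _ w0' h) ltxx.
have Kub : has_sup K.
  split; first by exists 0; rewrite /K/= scale0r.
  exists n%:R => k Kk; rewrite leNgt; apply/negP => nk; apply: nw.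
  rewrite -scaler_nat; apply: le_trans Kk; exact/vl_scale_le2/ltW.
exists (sup K).
(* The supremum is attained: some [k] in [K] within [1/(m+1)] of it gives [(m+1) (sup K w - a) <= w]
   for all [m]. *)
have ra : 0 <= a - sup K *: w.
  rewrite -oppr0 -[a - _]opprK; apply: vl_leN; rewrite opprB.
  apply: (archimedean_mulrn_le _ w) => // m.
  have mV : 0 < m.+1%:R^-1 :> R by rewrite invr_gt0.
  have [k Kk mk] := sup_adherent mV Kub.
  rewrite -[w in X in _ <= X](scalerKV (_ : m.+1%:R != 0 :> R)) ?pnatr_eq0//.
  apply: vl_scale_le => //; rewrite vl_subr_le.
  have : sup K *: w <= (k + m.+1%:R^-1) *: w.
    by apply: vl_scale_le2 => //; rewrite -lerBlDr ltW.
  by move=> /le_trans; apply; rewrite scalerDl vl_leD.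
move=> _ ->; rewrite !ge0_vabs//; apply/eqP; apply: contraT => y0.
set y := vmeet _ _ in y0.
have {}y0 : 0 < y by rewrite lt_def y0 vmeet_ge0.
have [k wk] := watom y y0 (vmeetr _ _).
have k0 : 0 < k.
  rewrite ltNge; apply/negP => k0; suff /le_gtF : w <= 0 by rewrite w0.
  by apply: (le_trans wk); rewrite -(scale0r y) vl_scale_le2// ltW.
have kV : 0 < k^-1 by rewrite invr_gt0.
(* From [w <= k y] follows [k^-1 w <= y <= a - sup K w], so [sup K] could be raised by [k^-1]. *)
have : K (sup K + k^-1).
  rewrite /K/= scalerDl addrC -vl_le_subr; apply: le_trans (vmeetl _ w).
  rewrite -[X in _ <= X](scalerK (_ : k != 0)) ?gt_eqF//.
  by apply: vl_scale_le => //; exact: ltW.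
by move=> /(sup_upper_bound Kub); rewrite gerDl leNgt kV.
Qed.

(** Decomposing both parts of [x] gives [x = k w + z] with [z] disjoint from [w]. If [x] lies in the
    double complement, so does [z], hence [z = 0]. *)
Lemma atom_projection_band w : archimedean A -> 0 < w ->
  (forall y, 0 < y -> y <= w -> exists k, w <= k *: y) ->
  projection_band (dcompl (dcompl [set w])) /\
  forall x, dcompl (dcompl [set w]) x -> exists k, x = k *: w.
Proof.
move=> arch w0 watom; set W := dcompl [set w]; set P := dcompl W.
have Wi : vl_ideal W by exact: dcompl_ideal.
have Pi : vl_ideal P by exact: dcompl_ideal.
have Pw k : P (k *: w) by apply: (vl_idealZ k Pi); exact: dcompl_dcompl.
have dec x : exists k, W (x - k *: w).
  have [k Wk] := atom_decomp _ _ arch w0 (pospart_ge0 x) watom.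
  have [l Wl] := atom_decomp _ _ arch w0 (pospart_ge0 (- x)) watom.
  exists (k - l); suff -> : x - (k - l) *: w =
      -1 *: (pospart (- x) - l *: w) + (pospart x - k *: w).
    by case: Wi => _ + _; apply.
  by rewrite {1}[x]pospartB scalerBl scaleN1r !opprB [LHS]addrACA [RHS]addrACA
    [pospart x + _]addrC.
split.
  split; first exact: dcompl_band.
  exists W; split; first exact: dcompl_band.
  split.
    move=> x; have [k Wk] := dec x; exists (k *: w), (x - k *: w).
    by split; [exact: Pw|exact: Wk|rewrite addrC subrK].
  apply/seteqP; split=> [x [Px Wx]|x ->]; first exact: (dcomplI W x).
  by split; [case: Pi|case: Wi].
move=> x Px; have [k Wk] := dec x; exists k.
apply/eqP; rewrite -subr_eq0; apply/eqP; apply: (dcomplI W); split => //.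
by rewrite -scaleNr; apply: (vl_idealD Pi).
Qed.

(** * Ideals maximal without [u] *)

Lemma vl_ideal_vmeetl I x y : vl_ideal I -> 0 <= x -> 0 <= y -> I x ->
  I (vmeet x y).
Proof.
move=> [_ _ Is] x0 y0 Ix; apply: Is Ix _.
by rewrite !ge0_vabs ?vmeet_ge0 ?vmeetl.
Qed.

Lemma principal_ideal a : vl_ideal [set x | exists k, vabs x <= k *: vabs a].
Proof.
split.
- by exists 0; rewrite scale0r vabs0.
- move=> k x y [l xl] [m ym]; exists (`|k| * l + m); apply: (le_trans (vabsD _ _)).
  rewrite scalerDl vl_leD// -scalerA; apply: (le_trans (vabsZ _ _)).
  exact: vl_scale_le.
- by move=> x y [k yk] xy; exists k; exact: le_trans yk.
Qed.

Lemma maximal_avoiding_exists u I : vl_ideal I -> ~ I u ->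
  exists M, maximal_avoiding u M /\ I `<=` M.
Proof.
(* Zorn's lemma here also covers the empty chain, whose union is empty; adjoining [I] by union makes
   that case yield the ideal [I]. *)
move=> Ii Iu; pose P := [set X : set A | vl_ideal (X `|` I) /\ ~ (X `|` I) u].
have [F FP Ftot|M [[Mi Mu] Mmax]] := @Zorn_bigcup A P.
  have [I0 Il Is] := Ii.
  have lift X : F X -> X `|` I `<=` \bigcup_(X in F) X `|` I.
    by move=> FX z [Xz|Iz]; [left; exists X|right].
  split; last by move=> [[X FX Xu]|//]; case: (FP X FX) => _; apply; left.
  split; first by right.
  - have mix X k x y : F X -> (X `|` I) x -> (X `|` I) y ->
        (\bigcup_(X in F) X `|` I) (k *: x + y).
      move=> FX Xx Xy; apply: (lift X FX).
      by have [[_ + _] _] := FP X FX; apply.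
    move=> k x y [[X FX Xx]|Ix] [[Y FY Yy]|Iy].
    + have [XY|YX] := Ftot X Y FX FY.
        by apply: (mix Y) => //; left => //; exact: XY.
      by apply: (mix X) => //; left => //; exact: YX.
    + by apply: (mix X) => //; [left|right].
    + by apply: (mix Y) => //; [right|left].
    + by right; exact: Il.
  - move=> x y [[X FX Xy]|Iy] xy; last by right; exact: Is Iy xy.
    apply: (lift X FX); have [[_ _ Xs] _] := FP X FX.
    by apply: Xs xy; left.
exists (M `|` I); split; last by move=> x; right.
split => // J Ji Ju MJ; apply/seteqP; split => // x Jx.
apply: contrapT => Mx; apply: (Mmax J).
  by split=> [y My|/(_ x Jx)]; [apply: MJ; left|move=> Mx'; apply: Mx; left].
by rewrite /P/mkset setUidl// => y Iy; apply: MJ; right.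
Qed.

(* Some [n] has [n x] not below [u].  Let [M] be maximal without [u]
   above [(u - n x)^+]: if it contained [x], it would contain
   [n x + (u - n x)^+ >= u]. *)
Lemma maximal_avoiding_separates u x : archimedean A -> weak_order_unit u ->
  x <> 0 -> exists M, maximal_avoiding u M /\ ~ M x.
Proof.
move=> arch [u0 uunit] x0; have u0' := ltW u0.
have [n nxu] : exists n, ~ (vabs x *+ n <= u).
  by apply/existsNP => h; apply/x0/vabs_eq0/(arch _ _ _ h); exact: vabs_ge0.
pose d := u - vabs x *+ n.
have [M [Mm dM]] : exists M, maximal_avoiding u M /\
    [set x | exists k, vabs x <= k *: vabs (pospart d)] `<=` M.
  (* The ideal generated by [pospart d] misses [u]: if [u <= k d^+], then [(-d)^+] is disjoint from
     [u], hence 0, and [n |x| <= u]. *)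
  apply: (maximal_avoiding_exists _ _ (principal_ideal _)) => -[k].
  rewrite !ge0_vabs ?pospart_ge0// => ukd; apply: nxu.
  rewrite -vl_subr_ge0 -oppr0 -[u - _]opprK; apply/vl_leN/pospart_eq0/uunit.
  rewrite ge0_vabs ?pospart_ge0// vmeetC.
  apply: (vmeet_eq0_le _ (`|k| *: pospart d)); rewrite ?pospart_ge0//.
    apply: (le_trans ukd); apply: vl_scale_le2; first exact: pospart_ge0.
    exact: ler_norm.
  by rewrite vmeetZ_eq0 ?pospart_ge0// pospart_disjoint.
exists M; split => // Mx; have [Mi Mu _] := Mm; have [_ _ Ms] := Mi; apply: Mu.
have Md : M (pospart d) by apply: dM; exists 1; rewrite scale1r.
have : M (n%:R *: vabs x + pospart d).
  by case: (Mi) => _ + _; apply => //; exact: vl_ideal_vabs.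
move=> /Ms; apply; rewrite ge0_vabs//; apply: (le_trans _ (vabs_ge _)).
by rewrite scaler_nat -vl_subr_le pospart_ge.
Qed.

End VectorLatticeLemmas.

(** * Points of the Yosida space *)

Section IsolatedPoints.
Context {R : realType} {A : vectorLatticeType R} {u : A}.
Implicit Types (p q : yosida_space u) (x y w e : A).

Lemma yosida_space_eq p q : sval p `<=` sval q -> p = q.
Proof.
move=> pq; apply: eq_sig_hprop => [M|]; first exact: Prop_irrelevance.
have [qi qu _] := svalP q; have [_ _ pm] := svalP p.
by rewrite (pm _ qi qu pq).
Qed.

Lemma openE_hk (U : set (yosida_space u)) : open U = hk_open U.
Proof. by []. Qed.

Lemma open_notin x : open [set p : yosida_space u | ~ sval p x].
Proof. by move=> p hp; apply; apply: hp => q /=; exact: contrapT. Qed.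

(** The kernel of [[set p]] is [p] itself, and by maximality no other point contains [p]. *)
Lemma closed_set1 p : closed [set p].
Proof.
rewrite -[[set p]]setCK; apply: open_closedC; rewrite openE_hk => q; rewrite setCK => qp.
by apply/esym/yosida_space_eq => x px; apply: qp => r ->.
Qed.

Lemma isolated_open p : isolated [set: yosida_space u] p -> open [set p].
Proof.
move=> [_ [V pV VE]]; rewrite setIT in VE; rewrite VE in pV.
by move: pV; rewrite nbhsE => -[U [oU Up] Us]; rewrite (_ : [set p] = U)//;
  apply/seteqP; split => // _ ->.
Qed.

(** In hull-kernel terms, openness of [[set p]] says that the intersection of all other points is
    not contained in [p]. *)
Lemma isolated_separated p : isolated [set: yosida_space u] p ->
  exists e, [/\ 0 <= e, ~ sval p e & forall q, q <> p -> sval q e].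
Proof.
move=> /isolated_open; rewrite openE_hk => op.
have : ~ Defs.hull (Defs.kernel (~` [set p])) p by move=> /op; exact.
move=> /existsNP[e /not_implyP[Ke pe]]; exists (vabs e); split.
- exact: vabs_ge0.
- by have [pi _ _] := svalP p => /(vl_ideal_vabsN pi).
- by move=> q qp; have [qi _ _] := svalP q; apply: (vl_ideal_vabs qi); exact: Ke.
Qed.

Lemma eq0_yosida x : archimedean A -> weak_order_unit u ->
  (forall p, sval p x) -> x = 0.
Proof.
move=> arch uunit px; apply: contrapT => x0.
have [M [Mm Mx]] := maximal_avoiding_separates _ _ arch uunit x0.
exact/Mx/(px (exist _ M Mm)).
Qed.

(* If [w <= u] vanishes off [p] and [0 < y <= w], then [y] is not in [p],
   so [u <= m + k y] with [m] in [p].  Thus [(w - k y)^+ <= m] is in every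
   point, that is, [w <= k y]. *)
Lemma isolated_atom p w : archimedean A -> weak_order_unit u ->
  0 <= w -> w <= u -> (forall q, q <> p -> sval q w) ->
  forall y, 0 < y -> y <= w -> exists k, w <= k *: y.
Proof.
move=> arch uunit w0 wu qw y y0 yw; have y0' := ltW y0.
have qy q : q <> p -> sval q y.
  move=> /qw; have [[_ _ qs] _ _] := svalP q; move=> /qs; apply.
  by rewrite !ge0_vabs.
have py : ~ sval p y.
  move=> py; suff y_eq0 : y = 0 by move: y0; rewrite y_eq0 ltxx.
  apply: eq0_yosida => // q; have [->//|] := pselect (q = p); exact: qy.
have [m [k [pm m0 k0 um]]] := maximal_avoiding_step (svalP p) y0' py.
exists k; have ky0 : 0 <= k *: y by exact: vl_scale_ge0.
suff /pospart_eq0 : pospart (w - k *: y) = 0 by rewrite vl_subr_le addr0.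
apply: eq0_yosida => // q; have [->|qp] := pselect (q = p).
  have [[_ _ ps] _ _] := svalP p; apply: ps pm _.
  rewrite !ge0_vabs ?pospart_ge0//; apply: pospart_le => //.
  rewrite vl_subr_le addrC; apply: (le_trans wu).
  exact: (le_trans (vabs_ge _)).
have [[_ _ qs] _ _] := svalP q; apply: qs (qw q qp) _.
rewrite !ge0_vabs ?pospart_ge0//; apply: pospart_le => //.
by rewrite vl_subr_le -{1}[w]add0r vl_leD.
Qed.

(** * Sufficiently many projections *)

Lemma SMP_of_dense_isolated : archimedean A -> weak_order_unit u ->
  dense (isolated [set: yosida_space u]) -> SMP A.
Proof.
move=> arch uunit dns B Bb B0; have [Bi _] := Bb; have u0 := ltW uunit.1.
have [b Bb' b0] : exists2 b, B b & b <> 0.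
  apply: contrapT => nb; apply: B0; apply/seteqP; split=> [b Bb0|_ ->].
    by apply: contrapT => b0; apply: nb; exists b.
  by case: Bi.
have [M [Mm Mb]] := maximal_avoiding_separates _ _ arch uunit b0.
have [p [pb piso]] : [set p : yosida_space u | ~ sval p b] `&`
    isolated [set: yosida_space u] !=set0.
  by apply: dns; [exists (exist _ M Mm)|exact: open_notin].
have [e [e0 pe qe]] := isolated_separated _ piso.
have [pi pu _] := svalP p; have b0' := vabs_ge0 b.
pose c := vmeet (vabs b) e; have c0 : 0 <= c by exact: vmeet_ge0.
(* The factor [b] puts [w] in [B], [e] puts it in every point but [p], and [u] gives the bound
   [w <= u]. Primeness keeps [w] out of [p]. *)
pose w := vmeet c u; have w0 : 0 <= w by exact: vmeet_ge0.
have pw : ~ sval p w.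
  move=> /(maximal_avoiding_prime (svalP p) c0 u0)[|//].
  move=> /(maximal_avoiding_prime (svalP p) b0' e0)[|//].
  by move=> /(vl_ideal_vabsN pi).
have qw q : q <> p -> sval q w.
  move=> /qe eq; have [qi _ _] := svalP q; apply: vl_ideal_vmeetl => //.
  by rewrite /c vmeetC; exact: vl_ideal_vmeetl.
have {}w0 : 0 < w.
  by rewrite lt_def w0 andbT; apply/eqP => w0'; apply: pw; rewrite w0'; case: pi.
have Bw : B w.
  do 2![apply: vl_ideal_vmeetl => //]; exact: vl_ideal_vabs.
have watom := isolated_atom _ _ arch uunit (ltW w0) (vmeetr _ _) qw.
have [Pp PE] := atom_projection_band _ arch w0 watom.
exists (dcompl (dcompl [set w])); split => //.
- have : dcompl (dcompl [set w]) w by exact: dcompl_dcompl.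
  by move=> + PE0; rewrite PE0 => /= w_eq0; move: w0; rewrite w_eq0 ltxx.
(* The projection band is the line spanned by [w], which lies in [B]. *)
- by move=> x /PE[k ->]; exact: vl_idealZ.
Qed.

(** * The representation at an isolated point *)

Lemma isolated_lambda (eta : A -> yosida_space u -> \bar R) p :
  yosida_representation eta -> isolated [set: yosida_space u] p ->
  lambda_family eta [set p].
Proof.
move=> etaY piso; have op := isolated_open _ piso; have cp := closed_set1 p.
split => // a.
have [e [e0 e1]] := yosida_separates etaY (open_closedC op) cp (setICl _).
have [_ adense] := yosida_D etaY a.
(* The open set [[set p]] meets the dense set where [eta a] is finite, so [fine] below loses
   nothing. *)
have [_ [->/= afin]] := adense [set p] (ex_intro _ p erefl) op.
exists (fine (eta a p) *: e) => //; apply/funext => x.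
rewrite (yosida_scale etaY) /patch; case: ifPn => [|xp].
  by rewrite inE => ->; rewrite (e1 p erefl) mule1 fineK.
by rewrite e0 ?mule0//; move: xp; rewrite notin_setE.
Qed.

End IsolatedPoints.

Theorem theorem4p1 (R : realType) (A : vectorLatticeType R) (u : A) :
  archimedean A -> weak_order_unit u ->
  (forall eta : A -> yosida_space u -> \bar R, yosida_representation eta ->
     forall p : yosida_space u,
       isolated [set: yosida_space u] p -> lambda_family eta [set p]) /\
  (dense (isolated [set: yosida_space u]) -> SMP A).
Proof.
move=> arch uunit; split; last exact: SMP_of_dense_isolated.
by move=> eta etaY p piso; exact: isolated_lambda.
Qed.
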